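(* Let $F:\mathbb{R}^3\to\mathbb{R}^3$, $F(x,y,z)=(\sigma(y-x),\,rx-y-xz,\,xy-bz)$, be the Lorenz vector field with $\sigma=10$, $b=8/3$ and $r$ between $13.926\ldots$ and $24.06$, and let $N$ be an isolating block of the Lorenz strange set $\mathcal L$. Then $\deg(F,N)=1$. Moreover, if $\hat N$ is an isolating block of the global attractor $\Omega$, then $\deg(F,\hat N)=-1$.
   Context: For the flow of $F$ with $\sigma=10$, $b=8/3$ and $r$ between $13.926\ldots$ (the value of the homoclinic bifurcation) and $24.06$ (where another bifurcation, involving the two branches of the unstable manifold of the origin, occurs), there is a global attractor $\Omega$, and $\Omega$ has an attractor-repeller decomposition $\{A,\mathcal L\}$ in which the attractor $A$ consists of two points and the repeller $\mathcal L$ is the Lorenz strange set. Here, for an isolated invariant set $\Omega$ and an attractor $A\subsetneq\Omega$ of the flow restricted to $\Omega$, the attractor-repeller decomposition is $\{A,\mathcal L\}$ with $\mathcal L=\{x\in\Omega:\omega(x)\cap A=\emptyset\}$, $\omega(x)$ being the omega-limit set. An attractor is a compact invariant set that is stable and has a neighborhood $U$ such that $\omega(x)$ is nonempty and contained in it for every $x\in U$; it is global if $U$ can be taken to be the whole space. Write $xt$ for the flow and $xJ=\{xt:t\in J\}$. A compact invariant set is isolated if it is the maximal invariant subset of some neighborhood $N$ of itself (an isolating neighborhood). An isolating block (here $n=3$) is a compact isolating neighborhood $N$ for which there are compact sets $L,L'\subset\partial N$ (the exit and entrance sets) such that: (1) $\partial N=L\cup L'$; (2) for every $x\in L'$ there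 is $\varepsilon>0$ with $x[-\varepsilon,0)\subset\mathbb{R}^n\setminus N$, and for every $x\in L$ there is $\delta>0$ with $x(0,\delta)\subset\mathbb{R}^n\setminus N$; (3) for every $x\in\partial N\setminus L'$ there is $\varepsilon>0$ with $x[-\varepsilon,0)\subset\mathring N$, and for every $x\in\partial N\setminus L$ there is $\delta>0$ with $x(0,\delta]\subset\mathring N$. Isolating blocks are always assumed to be $n$-dimensional manifolds with boundary such that $L,L'$ are $(n-1)$-dimensional submanifolds of $\partial N$ with $\partial L=L\cap L'=\partial L'$, the points of $L\cap L'$ being exactly those where $F$ is tangent to $\partial N$. $\deg(F,N)$ is the Brouwer degree (with respect to $0$) of $F|_{\mathring N}$. *)

(* Defs.v *)
From HB Require Import structures.
From mathcomp Require Import all_boot all_order all_algebra.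
From mathcomp Require Import all_classical all_reals all_analysis.

Set Implicit Arguments.
Unset Strict Implicit.
Unset Printing Implicit Defensive.

Import Order.TTheory GRing.Theory Num.Theory.
Import numFieldNormedType.Exports.

Local Open Scope classical_set_scope.
Local Open Scope ring_scope.

Section LocalFlow.
Context {R : realType} {n : nat}.
Local Notation V := 'rV[R]_n.+1.
Implicit Types (F : V -> V) (A K N L S X : set V) (J : set R) (x y : V).

Definition solution_on F J (u : R -> V) : Prop :=
  forall s, J s -> is_derive s 1 u (F (u s)).

(* [flow F x t y] reads "x t is defined and equals y".  It is a relation
   because solutions need not exist for all times: those of the Lorenz system
   may blow up in backward time.  It is functional for locally Lipschitz F. *)
Definition flow F x (t : R) y : Prop :=
  exists (a b : R) (u : R -> V),
    [/\ a < 0 < b, a < t < b, solution_on F `]a, b[ u, u 0 = x & u t = y].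

(* xJ `<=` S; in particular x t is defined for every t in J *)
Definition orbit_in F x J S : Prop :=
  forall t, J t -> exists2 y, flow F x t y & S y.

Definition flow_invariant F K : Prop := forall x, K x -> orbit_in F x setT K.

Definition omega_limit F x : set V :=
  [set y | forall (U : set V) (T : R), nbhs y U ->
     exists t z, [/\ T <= t, flow F x t z & U z]].

(* attractor of the flow restricted to the phase space X *)
Definition attractor F X A : Prop :=
  [/\ compact A, A `<=` X, flow_invariant F A,
      forall U, open U -> A `<=` U ->
        exists W, [/\ open W, A `<=` W &
          forall x, W x -> X x -> orbit_in F x `[0, +oo[ U] &
      exists U, [/\ open U, A `<=` U &
        forall x, U x -> X x ->
          omega_limit F x !=set0 /\ omega_limit F x `<=` A]].

Definition global_attractor F A : Prop :=
  attractor F setT A /\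
  forall x, omega_limit F x !=set0 /\ omega_limit F x `<=` A.

Definition isolating_neighborhood F K N : Prop :=
  [/\ compact K, flow_invariant F K, K `<=` N° &
      forall K', flow_invariant F K' -> K' `<=` N -> K' `<=` K].

Definition isolated F K : Prop := exists N, isolating_neighborhood F K N.

Definition attractor_repeller_decomposition F (Omega A L : set V) : Prop :=
  [/\ isolated F Omega, attractor F Omega A, A `<` Omega &
      L = [set x | Omega x /\ omega_limit F x `&` A = set0]].

Definition homoclinic_orbit F (p : V) (u : R -> V) : Prop :=
  [/\ solution_on F setT u, u 0 <> p,
      u t @[t --> +oo] --> p & u t @[t --> -oo] --> p].

End LocalFlow.

Section Submanifolds.
Context {R : realType} {n : nat}.
Local Notation V := 'rV[R]_n.+1.
Implicit Types (S W : set V) (p v : V).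

Definition C1_on W (f : V -> V) : Prop :=
  forall x, W x -> differentiable f x /\ {for x, continuous (jacobian f)}.

(* the half-space {y_0 >= 0} of R^k, for 0 < k, inside R^k x {0} *)
Definition half_space (k : nat) : set V :=
  [set y | forall i : 'I_n.+1,
     (i = 0%N :> nat -> 0 <= y 0 i) /\ ((k <= i)%N -> y 0 i = 0)].

(* psi is a C^1 diffeomorphism from W onto its (open) image, straightening S *)
Definition slice_chart (k : nat) S p W (psi : V -> V) : Prop :=
  [/\ open W /\ W p, C1_on W psi, set_inj W psi,
      forall x, W x -> jacobian psi x \in unitmx &
      forall x, W x -> (S x <-> half_space k (psi x))].

(* k-dimensional embedded C^1 submanifold of R^(n+1), possibly with boundary *)
Definition submanifold (k : nat) S : Prop :=
  forall p, S p -> exists W psi, slice_chart k S p W psi.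

Definition manifold_boundary (k : nat) S : set V :=
  [set p | S p /\ exists W psi, slice_chart k S p W psi /\ psi p 0 0 = 0].

(* v is the velocity at p of a curve lying in S, which for a submanifold
   without boundary means that v belongs to the tangent space at p *)
Definition tangent_at S p v : Prop :=
  exists gamma : R -> V,
    [/\ gamma 0 = p, is_derive (0 : R) 1 gamma v & \forall t \near 0, S (gamma t)].

End Submanifolds.

Section IsolatingBlocks.
Context {R : realType} {n : nat}.
Local Notation V := 'rV[R]_n.+1.
Implicit Types (F : V -> V) (K N L S : set V).

Definition frontier S : set V := closure S `\` S°.

Definition block_structure F N (L L' : set V) : Prop :=
  [/\ [/\ compact L, compact L' & frontier N = L `|` L'],
      forall x, L' x ->
        exists2 e : R, 0 < e & orbit_in F x `[- e, 0[ (~` N),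
      forall x, L x ->
        exists2 d : R, 0 < d & orbit_in F x `]0, d[ (~` N),
      forall x, frontier N x -> ~ L' x ->
        exists2 e : R, 0 < e & orbit_in F x `[- e, 0[ N° &
      forall x, frontier N x -> ~ L x ->
        exists2 d : R, 0 < d & orbit_in F x `]0, d] N°].

Definition block_regularity F N (L L' : set V) : Prop :=
  [/\ submanifold n.+1 N, submanifold n L, submanifold n L',
      manifold_boundary n L = L `&` L' /\ manifold_boundary n L' = L `&` L' &
      forall x, frontier N x -> ((L `&` L') x <-> tangent_at (frontier N) x (F x))].

Definition isolating_block F K N : Prop :=
  [/\ compact N, isolating_neighborhood F K N &
      exists L L', block_structure F N L L' /\ block_regularity F N L L'].

End IsolatingBlocks.

Section BrouwerDegree.
Context {R : realType} {n : nat}.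
Local Notation V := 'rV[R]_n.+1.
Implicit Types (f g : V -> V) (U : set V).

Definition regular_at_zero U f : Prop :=
  [/\ {within closure U, continuous f}, C1_on U f,
      forall x, frontier U x -> f x <> 0 &
      forall x, U x -> f x = 0 -> \det (jacobian f x) != 0].

Definition signed_zero_count U f : int :=
  \sum_(x \in U `&` f @^-1` [set 0]) sgz (\det (jacobian f x)).

(* sup over closure U of |g - f| is less than the distance from 0 to
   f(frontier U), when U is bounded and f, g are continuous on closure U *)
Definition degree_close U f g : Prop :=
  forall x z, closure U x -> frontier U z -> `|g x - f x| < `|f z|.

(* Brouwer degree with respect to 0 of f on a bounded open set U, following
   the usual analytic construction: a signed count of zeros when f is C^1 with
   0 as a regular value, and otherwise the count for any such g sufficiently
   close to f (it does not depend on g).  The value is 0 when f has zeros on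
   the frontier of U, where the degree is undefined. *)
Definition brouwer_degree U f : int :=
  if `[< regular_at_zero U f >] then signed_zero_count U f
  else xget 0 [set d | exists g,
    [/\ regular_at_zero U g, degree_close U f g & d = signed_zero_count U g]].

End BrouwerDegree.

Definition lorenz {R : realType} (sigma r b : R) (p : 'rV[R]_3) : 'rV[R]_3 :=
  let x := p 0 0 in let y := p 0 1 in let z := p 0 2 in
  \row_(i < 3) [:: sigma * (y - x); r * x - y - x * z; x * y - b * z]`_i.

(* the parameter value 13.926... at which the origin has a homoclinic orbit *)
Definition homoclinic_value {R : realType} (rH : R) : Prop :=
  13 + 926 / 1000 <= rH < 13 + 927 / 1000 /\
  exists u, homoclinic_orbit (lorenz 10 rH (8 / 3)) 0 u.

(* Main.v *)
Require Import Defs.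
From mathcomp Require Import all_boot all_order all_algebra.
From mathcomp Require Import all_classical all_reals all_analysis.
From mathcomp Require Import ring lra.
Import Order.TTheory GRing.Theory Num.Theory.
Import numFieldNormedType.Exports.
Local Open Scope classical_set_scope.
Local Open Scope ring_scope.

(** For [1 < r] the Lorenz field has exactly three zeros, the origin and the two
    wing centres C+ and C-, and its Jacobian determinant is positive at the
    origin and negative at C+ and C-.  So 0 is a regular value and the degree on
    the interior of an isolating block is the signed number of zeros inside it.
    A zero in a block of [K] is an invariant point of the block, hence a point
    of [K]; conversely [K] lies in the interior of the block.  The degree is
    therefore the signed number of zeros in [K] (lemmas [isolating_zeros] and
    [degree_zeros]), and it remains to see which zeros lie in [Omega] and in
    [L].

    All three lie in [Omega], because an equilibrium is its own omega-limit:
    this gives 1 - 1 - 1 = -1.  For [L] one needs [A = {C+, C-}], which gives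
    degree 1 since then the origin, whose omega-limit set is itself, is the only
    zero in [L].  A two-point invariant set consists of equilibria
    ([lorenz_invariant_pair]), so the point is that the origin is not in [A]
    ([origin_not_attracting]).

    The origin is a saddle, but instability in the whole space is not enough:
    [A] is only stable relative to [Omega], so the instability has to be
    witnessed by points of [Omega].  Near the origin the function
    [saddle] = x y - z^2 satisfies saddle' >= |p|^2 / 2.  Hence an orbit that
    starts near the origin with [saddle] positive leaves a fixed ball, and for
    every e it was e-close to the origin at some time before the exit, with a
    delay bounded in terms of e only.  Since [Omega] is stable, this orbit can be kept as close to [Omega] as
    desired, and by Gronwall, applied backward from the exit time, it is
    shadowed by an orbit contained in [Omega].  That orbit starts near the
    origin and leaves a fixed neighborhood of [A], contradicting the stability
    of [A] in [Omega].

    Both uniqueness of solutions and the shadowing come from one Gronwall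
    estimate ([lorenz_separation]). *)

(** * Coordinates in dimension three *)

Lemma ord3P (i : 'I_3) : [\/ i = 0, i = 1 | i = 2].
Proof.
case: i => -[|[|[|//]]] i3; [apply: Or31|apply: Or32|apply: Or33]; exact: val_inj.
Qed.

Lemma rowE3 (R : realType) (p q : 'rV[R]_3) :
  p 0 0 = q 0 0 -> p 0 1 = q 0 1 -> p 0 2 = q 0 2 -> p = q.
Proof. by move=> h0 h1 h2; apply/rowP => i; have [->|->|->] := ord3P i. Qed.

Lemma sum_ord3 (V : nmodType) (f : 'I_3 -> V) : \sum_(i < 3) f i = f 0 + f 1 + f 2.
Proof.
rewrite !big_ord_recl big_ord0 addr0 addrA.
by congr (f _ + f _ + f _); exact: val_inj.
Qed.

Lemma det_mx22 (R : comNzRingType) (M : 'M[R]_2) :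
  \det M = M 0 0 * M 1 1 - M 0 1 * M 1 0.
Proof.
rewrite (expand_det_row _ 0) !big_ord_recl big_ord0 /cofactor !det_mx11 !mxE.
have l00 : lift (0 : 'I_2) (0 : 'I_1) = 1 by exact: val_inj.
have l10 : lift (1 : 'I_2) (0 : 'I_1) = 0 by exact: val_inj.
have o0 : (ord0 : 'I_2) = 0 by exact: val_inj.
rewrite !o0 !l00 !l10 /= expr0 expr1.
ring.
Qed.

Lemma det_mx33 (R : comNzRingType) (M : 'M[R]_3) :
  \det M = M 0 0 * (M 1 1 * M 2 2 - M 1 2 * M 2 1)
         - M 0 1 * (M 1 0 * M 2 2 - M 1 2 * M 2 0)
         + M 0 2 * (M 1 0 * M 2 1 - M 1 1 * M 2 0).
Proof.
rewrite (expand_det_row _ 0) sum_ord3 /cofactor !det_mx22 !mxE.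
have l00 : lift (0 : 'I_3) (0 : 'I_2) = 1 by exact: val_inj.
have l01 : lift (0 : 'I_3) (1 : 'I_2) = 2 by exact: val_inj.
have l10 : lift (1 : 'I_3) (0 : 'I_2) = 0 by exact: val_inj.
have l11 : lift (1 : 'I_3) (1 : 'I_2) = 2 by exact: val_inj.
have l20 : lift (2 : 'I_3) (0 : 'I_2) = 0 by exact: val_inj.
have l21 : lift (2 : 'I_3) (1 : 'I_2) = 1 by exact: val_inj.
rewrite !l00 !l01 !l10 !l11 !l20 !l21 /= expr0 expr1 expr2.
ring.
Qed.

(** * The derivative of the Lorenz field *)

Lemma lorenz0E (R : realType) (s r b : R) p :
  lorenz s r b p 0 0 = s * (p 0 1 - p 0 0).
Proof. by rewrite mxE. Qed.

Lemma lorenz1E (R : realType) (s r b : R) p :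
  lorenz s r b p 0 1 = r * p 0 0 - p 0 1 - p 0 0 * p 0 2.
Proof. by rewrite mxE. Qed.

Lemma lorenz2E (R : realType) (s r b : R) p :
  lorenz s r b p 0 2 = p 0 0 * p 0 1 - b * p 0 2.
Proof. by rewrite mxE. Qed.

Definition lorenzE := (lorenz0E, lorenz1E, lorenz2E).

(** The linear map that maps [v] to the derivative of the field at [p] along
    [v]: the linear part of the field plus its polarized quadratic part. *)
Definition lorenz_diff {R : realType} (s r b : R) (p v : 'rV[R]_3) : 'rV[R]_3 :=
  \row_(i < 3) [:: s * (v 0 1 - v 0 0);
                   r * v 0 0 - v 0 1 - (p 0 0 * v 0 2 + p 0 2 * v 0 0);
                   p 0 0 * v 0 1 + p 0 1 * v 0 0 - b * v 0 2]`_i.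

Section diff.
Context {R : realType}.
Implicit Types (s r b : R) (p v : 'rV[R]_3).

Lemma diff_coord p (i : 'I_3) :
  is_diff p (fun q : 'rV[R]_3 => q 0 i : R) (fun v => v 0 i).
Proof.
apply: DiffDef; first exact: differentiable_coord.
have @f : {linear 'rV[R]_3 -> R}.
  by exists (fun N : 'rV[R]_3 => N 0 i); do 2![eexists]; do ?[constructor];
     rewrite ?mxE// => ? *; rewrite ?mxE//; move=> ?; rewrite !mxE.
by rewrite (_ : (fun _ => _) = f) // diff_lin //; exact: coord_continuous.
Qed.

Lemma diff_lorenz s r b p : is_diff p (lorenz s r b) (lorenz_diff s r b p).
Proof.
have d0 := diff_coord p 0; have d1 := diff_coord p 1; have d2 := diff_coord p 2.
set x := (fun q : 'rV[R]_3 => q 0 0 : R) in d0.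
set y := (fun q : 'rV[R]_3 => q 0 1 : R) in d1.
set z := (fun q : 'rV[R]_3 => q 0 2 : R) in d2.
pose e (i : 'I_3) : 'rV[R]_3 := delta_mx 0 i.
have dl (f df : 'rV[R]_3 -> R) i : is_diff p f df ->
   is_diff p (fun q => f q *: e i) (fun v => df v *: e i).
  move=> fd; have sd := is_diff_scalel (f p) (e i).
  exact: (is_diff_comp fd sd).
(* the field is written as a sum of scalar functions times basis vectors, for
   which the product and sum rules apply *)
have -> : lorenz s r b =
  (fun q => (s *: (y - x)) q *: e 0) +
  (fun q => (r *: x - y - x * z) q *: e 1) +
  (fun q => (x * y - b *: z) q *: e 2).
  by apply/funext => q; apply: rowE3; rewrite lorenzE !mxE /=
    !(mulr1, mulr0, addr0, add0r).
have D := is_diffD (is_diffD (dl _ _ 0 (is_diffZ s (is_diffB d1 d0)))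
  (dl _ _ 1 (is_diffB (is_diffB (is_diffZ r d0) d1) (is_diffM d0 d2))))
  (dl _ _ 2 (is_diffB (is_diffM d0 d1) (is_diffZ b d2))).
apply: (is_diff_eq D).
by apply/funext => v; apply: rowE3; rewrite !mxE /=
    !(mulr1, mulr0, addr0, add0r).
Qed.

End diff.

Lemma cvg_mx_entries {R : realType} {T : Type} (F : set_system T) {FF : Filter F}
    m n (f : T -> 'M[R]_(m, n)) (M : 'M[R]_(m, n)) :
  (forall i j, f x i j @[x --> F] --> M i j) -> f @ F --> M.
Proof.
move=> fM A [P MP PA]; apply: filterS PA _ => /=.
rewrite nbhs_filterE/=.
have H : \forall x \near F, forall i j, P i j (f x i j).
  apply: filter_forall => i; apply: filter_forall => j.
  exact: (fM i j _ (MP i j)).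
by apply: filterS H.
Qed.

Lemma jacobian_lorenzE {R : realType} (s r b : R) p i j :
  jacobian (lorenz s r b) p i j = lorenz_diff s r b p (delta_mx 0 i) 0 j.
Proof.
by rewrite /jacobian mxE; have D := diff_lorenz s r b p; rewrite diff_val.
Qed.

Lemma lorenz_C1 {R : realType} (s r b : R) W : C1_on W (lorenz s r b).
Proof.
move=> p _; split; first by have D := diff_lorenz s r b p; exact: ex_diff.
apply: (@cvg_mx_entries _ _ _ (nbhs_filter p) _ _ (jacobian (lorenz s r b))) => i j.
have -> : (fun q => jacobian (lorenz s r b) q i j) =
  (fun q => lorenz_diff s r b q (delta_mx 0 i) 0 j).
  by apply/funext => q; rewrite jacobian_lorenzE.
rewrite jacobian_lorenzE.
have c k : q 0 k @[q --> p] --> (p 0 k : R) by exact: coord_continuous.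
have cw k (w : R) : q 0 k * w @[q --> p] --> (p 0 k * w : R).
  exact: cvgM (c k) (cvg_cst w).
under eq_fun do rewrite !mxE.
rewrite !mxE.
have [->|->|->] := ord3P j => /=.
- exact: cvg_cst.
- exact: cvgB (cvg_cst _) (cvgD (cw _ _) (cw _ _)).
- exact: cvgB (cvgD (cw _ _) (cw _ _)) (cvg_cst _).
Qed.

Lemma det_jacobian_lorenz {R : realType} (s r b : R) p :
  \det (jacobian (lorenz s r b) p) =
  - s * (b * (1 - r + p 0 2) + p 0 0 * (p 0 0 + p 0 1)).
Proof.
rewrite det_mx33 !jacobian_lorenzE !mxE /=.
ring.
Qed.

(** * Equilibria *)

Lemma lorenz_eq0 {R : realType} (s r b : R) p : s != 0 ->
  lorenz s r b p = 0 <->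
  [/\ p 0 1 = p 0 0, p 0 0 * (r - 1 - p 0 2) = 0 & p 0 0 ^+ 2 = b * p 0 2].
Proof.
move=> s0; split=> [/rowP F0|[h1 h2 h3]].
  have := F0 0; have := F0 1; have := F0 2; rewrite !lorenzE !mxE => f2 f1 f0.
  have h1 : p 0 1 = p 0 0.
    by apply/eqP; rewrite -subr_eq0; move/eqP: f0; rewrite mulf_eq0 (negbTE s0).
  move: f1 f2; rewrite h1 => f1 f2; split => //.
    by apply: etrans f1; ring.
  by apply/eqP; rewrite -subr_eq0; apply/eqP; apply: etrans f2; ring.
apply: rowE3; rewrite lorenzE mxE; first by rewrite h1; ring.
  by rewrite h1; apply: etrans h2; ring.
by rewrite h1 -expr2 h3 subrr.
Qed.

(** For [c ^+ 2 = b * (r - 1)] this is an equilibrium, the centre of one of the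
    two wings of the butterfly. *)
Definition wing {R : realType} (r c : R) : 'rV[R]_3 :=
  \row_(i < 3) [:: c; c; r - 1]`_i.

Lemma lorenz_equilibria {R : realType} (s r b : R) p : s != 0 -> 0 < b -> 1 < r ->
  lorenz s r b p = 0 <->
  [\/ p = 0, p = wing r (Num.sqrt (b * (r - 1)))
    | p = wing r (- Num.sqrt (b * (r - 1)))].
Proof.
move=> s0 b0 r1.
set c := Num.sqrt _.
have c2 : c ^+ 2 = b * (r - 1) by rewrite sqr_sqrtr// mulr_ge0 ?subr_ge0 ?ltW.
rewrite lorenz_eq0//; split=> [[h1 h2 h3]|[->|->|->]]; last first.
- by rewrite !mxE/= sqrrN c2 subrr mulr0.
- by rewrite !mxE/= c2 subrr mulr0.
- by rewrite !mxE/= expr0n mulr0 mul0r.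
move/eqP: h2; rewrite mulf_eq0 => /orP[/eqP x0|].
  apply: Or31; apply: rowE3; rewrite mxE ?h1//.
  move/esym/eqP: h3; rewrite x0 expr0n mulf_eq0 gt_eqF//= => /eqP ->//.
rewrite subr_eq0 => /eqP z1.
move: h3; rewrite -z1 -c2 => /eqP; rewrite eqf_sqr => /orP[]/eqP x0.
  by apply: Or32; apply: rowE3; rewrite mxE ?h1.
by apply: Or33; apply: rowE3; rewrite mxE ?h1.
Qed.

(** * Growth estimates along solutions *)

Lemma is_derive_coord {R : realType} {n : nat} (u : R -> 'rV[R]_n)
    (t : R) (v : 'rV[R]_n) i :
  is_derive t 1 u v -> is_derive t 1 (fun s => u s 0 i : R) (v 0 i).
Proof.
move=> [du uv]; split; first exact: (derivable_mxP u t 1).1.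
by rewrite -uv derive_mx// mxE.
Qed.

Lemma is_derive_continuous {R : realType} (f df : R -> R) (A : set R) :
  (forall s, A s -> is_derive s 1 f (df s)) -> {within A, continuous f}.
Proof.
move=> fd; apply: continuous_in_subspaceT => s /set_mem /fd fs.
exact/differentiable_continuous/derivable1_diffP/ex_derive.
Qed.

(** The function [f s * expR (- K * (s - a))] has nonpositive derivative. *)
Lemma gronwall {R : realType} (K : R) (f df : R -> R) (a b : R) : a <= b ->
  (forall s, `[a, b]%classic s -> is_derive s 1 f (df s)) ->
  (forall s, `[a, b]%classic s -> df s <= K * f s) ->
  f b <= f a * expR (K * (b - a)).
Proof.
move=> ab fd dfK.
pose g s := f s * expR (- K * (s - a)).
pose dg s := (df s - K * f s) * expR (- K * (s - a)).
have gd s : `[a, b]%classic s -> is_derive s 1 g (dg s).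
  move=> st; have fs := fd s st.
  have ed : is_derive s 1 (fun s => expR (- K * (s - a)))
      (- K * expR (- K * (s - a))).
    have k1 : is_derive s 1 (fun s => - K * (s - a)) (- K).
      by apply: is_derive_eq; rewrite /GRing.scale/= subr0 mulr1.
    by rewrite mulrC; exact: is_derive1_comp.
  by apply: is_derive_eq; rewrite /dg /GRing.scale/=; ring.
have : g b - g a <= 0.
  have gc : {within `[a, b], continuous g} by exact: is_derive_continuous gd.
  have gd' s : s \in `]a, b[ -> is_derive s 1 g (dg s).
    by move=> /subset_itv_oo_cc st; exact: gd.
  have [c ct ->] := @MVT_segment R g dg a b ab gd' gc.
  rewrite mulr_le0_ge0 ?subr_ge0// mulr_le0_ge0 ?expR_ge0// subr_le0.
  exact: dfK.
rewrite subr_le0 /g subrr mulr0 expR0 mulr1 mulNr expRN.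
by rewrite ler_pdivrMr ?expR_gt0.
Qed.

(** Forward Gronwall for [- f] with rate [- K]. *)
Lemma gronwall_backward {R : realType} (K : R) (f df : R -> R) (a b : R) : a <= b ->
  (forall s, `[a, b]%classic s -> is_derive s 1 f (df s)) ->
  (forall s, `[a, b]%classic s -> - K * f s <= df s) ->
  f a <= f b * expR (K * (b - a)).
Proof.
move=> ab fd dfK.
have Nfd s : `[a, b]%classic s -> is_derive s 1 (- f) (- df s).
  by move=> /fd fs; exact: is_deriveN.
have : (- f) b <= (- f) a * expR (- K * (b - a)).
  apply: (gronwall _ _ _ _ _ ab Nfd) => s /dfK.
  by rewrite -lerN2 mulNr opprK mulNr [(- f) s]/(- f s) mulrN opprK.
rewrite [(- f) a]/(- f a) [(- f) b]/(- f b) mulNr lerN2 mulNr expRN.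
by rewrite ler_pdivrMr ?expR_gt0.
Qed.

(** The squared Euclidean norm; unlike the norm of row vectors, which is a
    maximum, it is differentiable. *)
Definition sqnorm3 {R : realType} (w : 'rV[R]_3) : R :=
  w 0 0 ^+ 2 + w 0 1 ^+ 2 + w 0 2 ^+ 2.

Lemma sqnorm3_ge0 {R : realType} (w : 'rV[R]_3) : 0 <= sqnorm3 w.
Proof. by rewrite !addr_ge0// sqr_ge0. Qed.

Lemma sqnorm3_eq0 {R : realType} (w : 'rV[R]_3) : sqnorm3 w <= 0 -> w = 0.
Proof.
rewrite /sqnorm3 => w0.
have := sqr_ge0 (w 0 0); have := sqr_ge0 (w 0 1); have := sqr_ge0 (w 0 2).
move=> h2 h1 h0.
by apply: rowE3; rewrite [RHS]mxE; apply/eqP;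
  rewrite -sqrf_eq0 eq_le ?h0 ?h1 ?h2 andbT; lra.
Qed.

(** Twice the scalar product of [p - q] with the difference of the fields: the
    derivative of the squared distance of two solutions.  The quadratic part of
    the field is energy-preserving, so a bound on one of the two points
    suffices. *)
Lemma lorenz_energy {R : realType} (s r b M : R) (p q : 'rV[R]_3) :
  q 0 1 ^+ 2 + q 0 2 ^+ 2 <= M ->
  `|\sum_(i < 3) 2 * ((p - q) 0 i * (lorenz s r b p - lorenz s r b q) 0 i)| <=
  (2 * (2 * `|s| + `|r| + `|b| + 2 * M + 3)) * sqnorm3 (p - q).
Proof.
move=> qM.
have bnd (c C x y S : R) : `|c| <= C -> `|x * y| <= S ->
      - (C * S) <= c * (x * y) <= C * S.
  by move=> cC xyS; rewrite -ler_norml normrM; exact: ler_pM.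
have sq1 (x : R) : `|x| <= 1 + x ^+ 2.
  by rewrite ler_norml; apply/andP; split; nra.
set x := (p - q) 0 0; set y := (p - q) 0 1; set z := (p - q) 0 2.
set S := sqnorm3 _.
have SE : S = x ^+ 2 + y ^+ 2 + z ^+ 2 by [].
(* every product of two coordinates of the difference is at most [S] *)
have nS (a c : R) : a ^+ 2 + c ^+ 2 <= 2 * S -> `|a * c| <= S.
  have m2 := sqr_ge0 (a - c); have p2 := sqr_ge0 (a + c).
  by move=> acS; rewrite ler_norml; apply/andP; split; lra.
have x2 := sqr_ge0 x; have y2 := sqr_ge0 y; have z2 := sqr_ge0 z.
have xx : `|x * x| <= S by apply: nS; rewrite SE; lra.
have xy : `|x * y| <= S by apply: nS; rewrite SE; lra.
have xz : `|x * z| <= S by apply: nS; rewrite SE; lra.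
have yy : `|y * y| <= S by apply: nS; rewrite SE; lra.
have zz : `|z * z| <= S by apply: nS; rewrite SE; lra.
have /andP[h1 h1'] : - (`|s| * S) <= s * (x * y) <= `|s| * S by apply: bnd.
have /andP[h2 h2'] : - (`|s| * S) <= (- s) * (x * x) <= `|s| * S.
  by apply: bnd; rewrite ?normrN.
have /andP[h3 h3'] : - (`|r| * S) <= r * (x * y) <= `|r| * S by apply: bnd.
have /andP[h4 h4'] : - (`|b| * S) <= (- b) * (z * z) <= `|b| * S.
  by apply: bnd; rewrite ?normrN.
have /andP[h5 h5'] : - (1 * S) <= (- 1) * (y * y) <= 1 * S.
  by apply: bnd; rewrite ?normrN ?normr1.
have /andP[h6 h6'] : - ((1 + M) * S) <= (- q 0 2) * (x * y) <= (1 + M) * S.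
  by apply: bnd; rewrite ?normrN//; apply: le_trans (sq1 _) _; nra.
have /andP[h7 h7'] : - ((1 + M) * S) <= (q 0 1) * (x * z) <= (1 + M) * S.
  by apply: bnd; rewrite ?normrN//; apply: le_trans (sq1 _) _; nra.
rewrite sum_ord3 -/x -/y -/z.
have e i : (lorenz s r b p - lorenz s r b q) 0 i =
  lorenz s r b p 0 i - lorenz s r b q 0 i by rewrite !mxE.
rewrite !e !lorenzE.
have px : p 0 0 = q 0 0 + x by rewrite /x !mxE; ring.
have py : p 0 1 = q 0 1 + y by rewrite /y !mxE; ring.
have pz : p 0 2 = q 0 2 + z by rewrite /z !mxE; ring.
rewrite px py pz.
(* the terms in y z cancel: this is the conservation of energy *)
rewrite [X in `|X|](_ : _ = 2 * (s * (x * y) + (- s) * (x * x) + r * (x * y)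
  + (- b) * (z * z) + (- 1) * (y * y) + (- q 0 2) * (x * y) + q 0 1 * (x * z)));
  last by ring.
by rewrite ler_norml; apply/andP; split; lra.
Qed.

(** Gronwall in both time directions.  The constant depends on a bound for one
    of the two solutions only, so the other one needs no a priori bound. *)
Lemma lorenz_separation {R : realType} (s r b M : R) :
  exists2 K : R, 0 <= K & forall (u v : R -> 'rV[R]_3) (t1 t2 : R), t1 <= t2 ->
  solution_on (lorenz s r b) `[t1, t2] u ->
  solution_on (lorenz s r b) `[t1, t2] v ->
  (forall t, `[t1, t2]%classic t -> v t 0 1 ^+ 2 + v t 0 2 ^+ 2 <= M) ->
  sqnorm3 (u t2 - v t2) <= sqnorm3 (u t1 - v t1) * expR (K * (t2 - t1)) /\
  sqnorm3 (u t1 - v t1) <= sqnorm3 (u t2 - v t2) * expR (K * (t2 - t1)).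
Proof.
set K0 := (2 * (2 * `|s| + `|r| + `|b| + 2 * M + 3)).
exists `|K0| => // u v t1 t2 t12 us vs vM.
pose df x := \sum_(i < 3) 2 * ((u x - v x) 0 i *
  (lorenz s r b (u x) - lorenz s r b (v x)) 0 i).
have fd x : `[t1, t2]%classic x ->
    is_derive x 1 (fun x => sqnorm3 (u x - v x)) (df x).
  move=> xt.
  have dw i : is_derive x 1 (fun x => (u x - v x) 0 i : R)
    ((lorenz s r b (u x) - lorenz s r b (v x)) 0 i).
    apply: is_derive_coord; have := us x xt; have := vs x xt => dv du.
    exact: is_deriveB.
  have d0 := dw 0; have d1 := dw 1; have d2 := dw 2.
  apply: is_derive_eq; rewrite /df sum_ord3 /GRing.scale/=; ring.
have dfK x : `[t1, t2]%classic x -> `|df x| <= `|K0| * sqnorm3 (u x - v x).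
  move=> xt; apply: le_trans (lorenz_energy _ _ _ _ _ _ (vM x xt)) _.
  by rewrite ler_wpM2r ?sqnorm3_ge0// ler_norm.
split.
  apply: (gronwall _ _ _ _ _ t12 fd) => x /dfK; exact: le_trans (ler_norm _).
apply: (gronwall_backward _ _ _ _ _ t12 fd) => x /dfK.
by rewrite ler_norml mulNr => /andP[].
Qed.

Lemma lorenz_unique {R : realType} (s r b : R) (u v : R -> 'rV[R]_3) (t : R) :
  0 <= t -> solution_on (lorenz s r b) `[0, t] u ->
  solution_on (lorenz s r b) `[0, t] v -> u 0 = v 0 -> u t = v t.
Proof.
move=> t0 us vs uv0.
have vd i x : `[0, t]%classic x ->
    is_derive x 1 (fun x => v x 0 i : R) (lorenz s r b (v x) 0 i).
  by move=> /vs; exact: is_derive_coord.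
(* a bound on [v], by compactness of the time interval *)
have [c _ vM] : exists2 c, c \in `[0, t] & forall x, x \in `[0, t] ->
    v x 0 1 ^+ 2 + v x 0 2 ^+ 2 <= v c 0 1 ^+ 2 + v c 0 2 ^+ 2.
  apply: (@EVT_max R (fun x => v x 0 1 ^+ 2 + v x 0 2 ^+ 2)) => //.
  apply: (is_derive_continuous _
    (fun x => 'D_1 (fun x => v x 0 1 ^+ 2 + v x 0 2 ^+ 2) x)) => x xt.
  have d1 := vd 1 x xt; have d2 := vd 2 x xt.
  exact: derivableP.
have [K _ /(_ u v 0 t t0 us vs vM)[+ _]] := lorenz_separation s r b
  (v c 0 1 ^+ 2 + v c 0 2 ^+ 2).
have -> : sqnorm3 (u 0 - v 0) = 0.
  by rewrite uv0 subrr /sqnorm3 !mxE expr0n !addr0.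
rewrite mul0r => /sqnorm3_eq0 /eqP.
by rewrite subr_eq0 => /eqP.
Qed.

(** * Flow relation, equilibria and invariant pairs *)

Section flow.
Context {R : realType}.

Lemma nbhs_setC1 n (x y : 'rV[R]_n) : x <> y -> nbhs x (~` [set y]).
Proof.
move=> xy; apply: open_nbhs_nbhs; split=> //; apply/closed_openC.
exact/accessible_closed_set1/hausdorff_accessible/norm_hausdorff.
Qed.

Lemma equilibrium_flow n (F : 'rV[R]_n.+1 -> 'rV[R]_n.+1) x t :
  F x = 0 -> flow F x t x.
Proof.
move=> Fx; exists (- (`|t| + 1)), (`|t| + 1), (cst x).
have t1 : 0 < `|t| + 1 by rewrite ltr_wpDl.
split=> //; first by rewrite oppr_lt0 t1.
  by rewrite -ltr_norml ltrDl.
by move=> s _; rewrite /cst Fx; exact: is_derive_cst.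
Qed.

Lemma equilibrium_omega_limit n (F : 'rV[R]_n.+1 -> 'rV[R]_n.+1) x :
  F x = 0 -> omega_limit F x x.
Proof.
move=> Fx U T /nbhs_singleton Ux.
by exists T, x; split => //; exact: equilibrium_flow.
Qed.

(** The singleton of an equilibrium is an invariant subset of [N]. *)
Lemma equilibrium_isolating n (F : 'rV[R]_n.+1 -> 'rV[R]_n.+1) K N x :
  isolating_neighborhood F K N -> N x -> F x = 0 -> K x.
Proof.
move=> [_ _ _ Kmax] Nx Fx; apply: (Kmax [set x]) => //; last by move=> _ ->.
by move=> _ -> t _; exists x => //; exact: equilibrium_flow.
Qed.

Lemma flow_solution n (F : 'rV[R]_n.+1 -> 'rV[R]_n.+1) x t y : 0 <= t ->
  flow F x t y -> exists u, [/\ solution_on F `[0, t] u, u 0 = x & u t = y].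
Proof.
move=> t0 [a [b [u [/andP[a0 b0] /andP[at_ tb] us ux uy]]]].
exists u; split => // s; rewrite /= in_itv/= => /andP[s0 st]; apply: us.
by rewrite /= in_itv/= (lt_le_trans a0)//= (le_lt_trans st).
Qed.

Lemma flow_solution_backward n (F : 'rV[R]_n.+1 -> 'rV[R]_n.+1) x t y : 0 <= t ->
  flow F x (- t) y -> exists u, [/\ solution_on F `[- t, 0] u, u 0 = x & u (- t) = y].
Proof.
move=> t0 [a [b [u [/andP[a0 b0] /andP[at_ tb] us ux uy]]]].
exists u; split => // s; rewrite /= in_itv/= => /andP[s0 st]; apply: us.
by rewrite /= in_itv/= (lt_le_trans at_)//= (le_lt_trans st).
Qed.

Lemma solution_shift n (F : 'rV[R]_n.+1 -> 'rV[R]_n.+1)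
    (u : R -> 'rV[R]_n.+1) a b c :
  solution_on F `[a, b] u ->
  solution_on F `[a - c, b - c] (fun s => u (s + c)).
Proof.
move=> us s; rewrite /= in_itv/= => sab.
have [] : is_derive (s + c) 1 u (F (u (s + c))).
  apply: us; rewrite /= in_itv/=; move: sab; lra.
rewrite /derivable /derive => du uv.
by split; rewrite /derivable /derive; under eq_fun do rewrite /= -addrA.
Qed.

Lemma solution_sub n (F : 'rV[R]_n.+1 -> 'rV[R]_n.+1)
    (u : R -> 'rV[R]_n.+1) (J J' : set R) :
  J' `<=` J -> solution_on F J u -> solution_on F J' u.
Proof. by move=> sJ us s /sJ; exact: us. Qed.

Lemma lorenz_flow_unique (s r b : R) u t y : 0 <= t ->
  solution_on (lorenz s r b) `[0, t] u -> flow (lorenz s r b) (u 0) t y -> y = u t.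
Proof.
move=> t0 us /(flow_solution _ _ _ _ _ t0)[v [vs vx <-]].
exact: (lorenz_unique s r b).
Qed.

(** [orbit_in] provides a separate solution for every time; uniqueness glues
    them to a given solution. *)
Lemma lorenz_orbit_in (s r b : R) u J U t : 0 <= t -> J t ->
  solution_on (lorenz s r b) `[0, t] u -> orbit_in (lorenz s r b) (u 0) J U -> U (u t).
Proof.
move=> t0 Jt us /(_ t Jt)[y uy Uy].
by rewrite -(lorenz_flow_unique s r b u t y t0 us uy).
Qed.

Lemma lorenz_equilibrium_omega (s r b : R) x :
  lorenz s r b x = 0 -> omega_limit (lorenz s r b) x `<=` [set x].
Proof.
move=> Fx y oy; apply: contrapT => yx.
have [t [z [t0 xz zx]]] := oy _ 0 (nbhs_setC1 _ _ _ yx); apply: zx => /=.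
apply: (lorenz_flow_unique s r b (cst x) t z t0 _ xz) => a _.
by rewrite /cst Fx; exact: is_derive_cst.
Qed.

Lemma solution_continuous n (F : 'rV[R]_n.+1 -> 'rV[R]_n.+1)
    (u : R -> 'rV[R]_n.+1) (J : set R) t :
  solution_on F J u -> J t -> {for t, continuous u}.
Proof.
move=> us /us ut.
by apply: differentiable_continuous; apply/derivable1_diffP; exact: ex_derive.
Qed.

(** The solution through [p] is continuous and takes its values in a discrete
    set, so it stays at [p] for a while and its velocity vanishes. *)
Lemma lorenz_invariant_pair (s r b : R) p q : p <> q ->
  flow_invariant (lorenz s r b) [set p; q] -> lorenz s r b p = 0.
Proof.
move=> pq inv; have := inv p (or_introl erefl) => orb.
have [y py _] := orb 1 I.
have [u [us up _]] := flow_solution _ _ _ _ _ ler01 py.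
have c0 : {for 0, continuous u}.
  by apply: (solution_continuous _ _ _ _ _ us); rewrite /= in_itv/= lexx ler01.
have nq : \forall t \near 0, u t <> q.
  have uq := nbhs_setC1 _ _ _ pq; rewrite -up in uq.
  exact: c0 uq.
have [d /= d0 dq] := nq.
pose e := Num.min d 1.
have e0 : 0 < e by rewrite lt_min d0/=.
have upe t : 0 <= t < e -> u t = p.
  rewrite lt_min => /and3P[t0 td t1].
  have us' : solution_on (lorenz s r b) `[0, t] u.
    apply: solution_sub us => z; rewrite /= !in_itv/= => /andP[-> zt].
    by rewrite (le_trans zt)// ltW.
  have := lorenz_orbit_in s r b u setT [set p; q] t t0 I us'.
  rewrite up => /(_ orb)[//|utq].
  have : ball 0 d t by rewrite /ball/= sub0r normrN ger0_norm.
  by move=> /dq; rewrite utq.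
(* the derivative is compared at an interior time, around which [u] is constant *)
have e2 : 0 < e / 2 < e by lra.
have ue2 : is_derive (e / 2) 1 u (lorenz s r b p).
  rewrite -[X in lorenz _ _ _ X](upe (e / 2)); last by lra.
  apply: us; rewrite /= in_itv/=.
  have : e <= 1 by rewrite ge_min lexx orbT.
  by lra.
have uc : is_derive (e / 2) 1 u 0.
  apply: (@near_eq_is_derive _ _ _ (cst p)).
  have : \forall t \near (e / 2), t \in `]0, e[.
    by apply: near_in_itvoo; rewrite in_itv/=.
  apply: filterS => t; rewrite in_itv/= => /andP[t0 te].
  by rewrite upe// ltW.
by rewrite -(@derive_val _ _ _ _ _ _ _ ue2) (@derive_val _ _ _ _ _ _ _ uc).
Qed.

End flow.

(** * The saddle function near the origin *)

Section origin.
Context {R : realType}.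

Lemma sqnorm3B (p q : 'rV[R]_3) : sqnorm3 p <= 2 * sqnorm3 (p - q) + 2 * sqnorm3 q.
Proof.
rewrite /sqnorm3 !mxE.
have h0 := sqr_ge0 (p 0 0 - 2 * q 0 0); have h1 := sqr_ge0 (p 0 1 - 2 * q 0 1).
have h2 := sqr_ge0 (p 0 2 - 2 * q 0 2); lra.
Qed.

Lemma sqnorm3_continuous (p : 'rV[R]_3) : {for p, continuous sqnorm3}.
Proof.
have ci i : q 0 i @[q --> p] --> (p 0 i : R) by exact: coord_continuous.
have c i : q 0 i * q 0 i @[q --> p] --> (p 0 i * p 0 i : R).
  exact: cvgM (ci i) (ci i).
have -> : @sqnorm3 R = fun q => q 0 0 * q 0 0 + q 0 1 * q 0 1 + q 0 2 * q 0 2.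
  by apply/funext => q; rewrite /sqnorm3 !expr2.
exact: cvgD (cvgD (c 0) (c 1)) (c 2).
Qed.

Lemma nbhs0_sqnorm3 (W : set 'rV[R]_3) : nbhs (0 : 'rV[R]_3) W ->
  exists2 e : R, 0 < e & forall p, sqnorm3 p < e -> W p.
Proof.
move=> /nbhs_ballP[e /= e0 eW]; exists (e ^+ 2); first by rewrite exprn_gt0.
move=> p pe; apply: eW; split => // i j; rewrite mxE /ball/= sub0r normrN.
rewrite -(@ltr_pXn2r _ 2)// ?nnegrE ?(ltW e0)// real_normK ?num_real//.
rewrite (ord1 i); apply: le_lt_trans pe; rewrite /sqnorm3.
have := sqr_ge0 (p 0 0); have := sqr_ge0 (p 0 1); have := sqr_ge0 (p 0 2).
by have [->|->|->] := ord3P j; lra.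
Qed.

(** The infimum of the times with [m <= f s] is such a time by continuity, and
    the intermediate value theorem before it excludes [m < f t]. *)
Lemma first_exit (f : R -> R) (T m : R) : 0 <= T ->
  (forall s, `[0, T]%classic s -> {for s, continuous f}) ->
  f 0 <= m -> m <= f T ->
  exists t, [/\ 0 <= t <= T, f t = m & forall s, 0 <= s <= t -> f s <= m].
Proof.
move=> T0 fc f0 fT.
pose E := [set s | 0 <= s <= T /\ m <= f s].
have ET : E T by split => //; rewrite T0 lexx.
have Elb : has_lbound E by exists 0 => s [/andP[]].
have hE : has_inf E by split => //; exists T.
pose t := inf E.
have t0 : 0 <= t by apply: lb_le_inf; [exists T|move=> s [/andP[]]].
have tT : t <= T by exact: ge_inf.
have tmin s : 0 <= s < t -> f s < m.
  move=> /andP[s0 st]; rewrite ltNge; apply/negP => ms.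
  suff : t <= s by rewrite leNgt st.
  by apply: ge_inf => //; split => //; rewrite s0 (le_trans (ltW st)).
have mft : m <= f t.
  rewrite leNgt; apply/negP => ftm.
  have ct : {for t, continuous f} by apply: fc; rewrite /= in_itv/= t0.
  have [d /= d0 dm] : \forall s \near t, f s < m by exact: cvgr_lt ct _ ftm.
  have [s [s0T ms] std] := inf_adherent d0 hE.
  have ts : t <= s by apply: ge_inf.
  have : f s < m by apply: dm; rewrite /ball/= distrC ger0_norm ?subr_ge0// ltrBlDl.
  by rewrite ltNge ms.
have [c ct fcm] : exists2 c, c \in `[0, t] & f c = m.
  apply: IVT => //.
    apply: continuous_in_subspaceT => s /set_mem /=; rewrite in_itv/= => /andP[s0 st].
    by apply: fc; rewrite /= in_itv/= s0 (le_trans st).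
  by rewrite ge_min f0 le_max mft orbT.
have ctE : c = t.
  move: ct; rewrite in_itv/= => /andP[c0 ct]; apply/eqP; rewrite eq_le ct/=.
  by apply: ge_inf => //; split; rewrite ?fcm// c0 (le_trans ct).
exists t; split; rewrite ?t0// -?ctE// => s /andP[s0]; rewrite ctE le_eqVlt.
by move=> /orP[/eqP -> |st]; [rewrite -ctE fcm|rewrite ltW// tmin// s0].
Qed.

(** A Chetaev function for the origin: it is positive on a cone around the
    unstable direction and grows along solutions near the origin.  The term in
    the third coordinate is there to make [saddle_dot] definite. *)
Definition saddle (p : 'rV[R]_3) : R := p 0 0 * p 0 1 - p 0 2 ^+ 2.

Definition saddle_dot (r : R) (p : 'rV[R]_3) : R :=
  let F := lorenz 10 r (8 / 3) p in
  F 0 0 * p 0 1 + p 0 0 * F 0 1 - 2 * p 0 2 * F 0 2.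

Lemma is_derive_saddle (r : R) (u : R -> 'rV[R]_3) (J : set R) t :
  solution_on (lorenz 10 r (8 / 3)) J u -> J t ->
  is_derive t 1 (fun s => saddle (u s)) (saddle_dot r (u t)).
Proof.
move=> us Jt.
have d i : is_derive t 1 (fun s => u s 0 i : R) (lorenz 10 r (8 / 3) (u t) 0 i).
  exact: is_derive_coord (us t Jt).
have d0 := d 0; have d1 := d 1; have d2 := d 2.
rewrite /saddle; apply: is_derive_eq; rewrite /saddle_dot /GRing.scale/=; ring.
Qed.

Lemma saddle_bounds (p : 'rV[R]_3) : - sqnorm3 p <= saddle p <= sqnorm3 p / 2.
Proof.
rewrite /saddle /sqnorm3; have h1 := sqr_ge0 (p 0 0 - p 0 1).
have h2 := sqr_ge0 (p 0 0 + p 0 1); have h3 := sqr_ge0 (p 0 2).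
have h4 := sqr_ge0 (p 0 0); have h5 := sqr_ge0 (p 0 1).
apply/andP; split; lra.
Qed.

(** In the ball one has [`|z| <= 1 / 2], so [saddle_dot] is at least
    [10 y^2 - 11 x y + 13 x^2 + 16 / 3 z^2 - 2 x y z], whose mixed terms are
    dominated by the squares. *)
Lemma saddle_dot_ge (r : R) (p : 'rV[R]_3) : 27 / 2 <= r -> sqnorm3 p <= 1 / 4 ->
  sqnorm3 p / 2 <= saddle_dot r p.
Proof.
rewrite /saddle_dot !lorenzE /sqnorm3.
set x := p 0 0; set y := p 0 1; set z := p 0 2 => r13 p4.
have x2 := sqr_ge0 x; have y2 := sqr_ge0 y; have z2 := sqr_ge0 z.
have /andP[z1 z3] : - (1 / 2) <= z <= 1 / 2 by apply/andP; split; nra.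
have h1 : 0 <= (r - 27 / 2) * x ^+ 2 by rewrite mulr_ge0// subr_ge0.
have h2 : 0 <= (1 / 2 - z) * x ^+ 2 by rewrite mulr_ge0// subr_ge0.
(* half the sum of the next two is x^2 / 2 + y^2 / 2 - 2 x y z *)
have h3 : 0 <= (1 / 2 - z) * (x + y) ^+ 2 by rewrite mulr_ge0 ?sqr_ge0// subr_ge0.
have h4 : 0 <= (1 / 2 + z) * (x - y) ^+ 2.
  by rewrite mulr_ge0 ?sqr_ge0// -lerBlDl sub0r.
have h5 := sqr_ge0 (9 * y - 11 / 2 * x).
lra.
Qed.

End origin.

(** * The origin does not belong to the attractor *)

Section instability.
Context {R : realType}.
Variable r : R.
Hypothesis r_large : 27 / 2 <= r.
Local Notation F := (lorenz 10 r (8 / 3)).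

(** While the solution stays in the ball, [saddle] grows exponentially, but it
    is bounded there; [expR T >= 1 + T] makes the escape time explicit. *)
Lemma saddle_escape (u : R -> 'rV[R]_3) (T : R) : 0 <= T ->
  solution_on F `[0, T] u -> 0 < saddle (u 0) -> (saddle (u 0))^-1 <= T ->
  exists2 s, 0 <= s <= T & 1 / 4 <= sqnorm3 (u s).
Proof.
move=> T0 us h0 hT; apply: contrapT => noexit.
have small s : `[0, T]%classic s -> sqnorm3 (u s) <= 1 / 4.
  rewrite /= in_itv/= => s0T; rewrite leNgt; apply/negP => /ltW su.
  by apply: noexit; exists s.
have Nd s : `[0, T]%classic s ->
    is_derive s 1 (fun s => - saddle (u s)) (- saddle_dot r (u s)).
  move=> st; have := is_derive_saddle _ _ _ _ us st => d.
  exact: is_deriveN.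
have := gronwall 1 _ _ _ _ T0 Nd; rewrite subr0 mul1r => G.
have {G} : - saddle (u T) <= - saddle (u 0) * expR T.
  apply: G => s st; rewrite mul1r lerN2.
  apply: le_trans (saddle_dot_ge _ _ r_large (small s st)).
  by have /andP[] := saddle_bounds (u s).
have uT : sqnorm3 (u T) <= 1 / 4 by apply: small; rewrite /= in_itv/= T0 lexx.
have /andP[_ bT] := saddle_bounds (u T).
have e1 : 1 + T <= expR T by exact: expR_ge1Dx.
have h1 : 1 <= saddle (u 0) * T by rewrite -ler_pdivrMl// mulr1.
have h2 : saddle (u 0) * (1 + T) <= saddle (u 0) * expR T by rewrite ler_pM2l.
rewrite mulNr; lra.
Qed.

(** If the solution has spent more than a time [S] in the ball, then [saddle],
    which varies by at most [3 / 8], has by the mean value theorem a small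
    derivative at some of the last [S] instants, and this derivative controls
    the norm.  Otherwise the initial point is close to the origin itself. *)
Lemma saddle_close (u : R -> 'rV[R]_3) (T S e : R) : 0 <= T -> 0 < e -> 1 <= S * e ->
  solution_on F `[0, T] u -> (forall s, 0 <= s <= T -> sqnorm3 (u s) <= 1 / 4) ->
  sqnorm3 (u 0) <= e ->
  exists c, [/\ 0 <= c <= T, T - c <= S & sqnorm3 (u c) <= e].
Proof.
move=> T0 e0 Se us uT u0; have [TS|ST] := leP T S.
  by exists 0; rewrite lexx T0 subr0.
have S0 : 0 < S by rewrite -(pmulr_lgt0 _ e0) (lt_le_trans _ Se).
have dom s : `[T - S, T]%classic s -> 0 <= s <= T.
  by rewrite /= in_itv/= => /andP[s1 s2]; apply/andP; split; lra.
have d s : `[T - S, T]%classic s ->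
    is_derive s 1 (fun s => saddle (u s)) (saddle_dot r (u s)).
  move=> /dom st; apply: (is_derive_saddle _ _ _ _ us).
  by rewrite /= in_itv.
have d' s : s \in `]T - S, T[ ->
    is_derive s 1 (fun s => saddle (u s)) (saddle_dot r (u s)).
  by move=> /subset_itv_oo_cc st; exact: d.
have TST : T - S <= T by lra.
have [c ct E] := MVT_segment TST d' (is_derive_continuous _ _ _ d).
have cT := dom c ct.
exists c; split => //; first by move: ct; rewrite in_itv/= => /andP[]; lra.
have := saddle_dot_ge _ _ r_large (uT c cT).
have /andP[_ b1] := saddle_bounds (u T).
have /andP[b2 _] := saddle_bounds (u (T - S)).
have n1 := uT T; have n2 := uT (T - S).
have {}n1 : sqnorm3 (u T) <= 1 / 4 by apply: n1; rewrite T0 lexx.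
have {}n2 : sqnorm3 (u (T - S)) <= 1 / 4 by apply: n2; lra.
have {}E : saddle_dot r (u c) * S <= 3 / 8.
  rewrite (_ : S = T - (T - S)); last by ring.
  rewrite -E; lra.
move=> dc.
have : sqnorm3 (u c) / 2 * S <= e / 2 * S.
  apply: le_trans (_ : saddle_dot r (u c) * S <= _); first by rewrite ler_pM2r.
  by apply: le_trans E _; lra.
rewrite ler_pM2r//; lra.
Qed.

(** Stability of [A] concerns only points of [Omega], so an orbit inside [Omega]
    leaving the origin is needed.  It is found by shadowing.  By stability of
    [Omega] in the whole space, an orbit starting very close to the origin, in
    the cone where [saddle] is positive, remains near [Omega] while it crosses
    the sphere [sqnorm3 = 1 / 4].  At the first crossing time it is close to
    some [y] in [Omega].  Shortly before, after a delay bounded by [S], it was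
    close to the origin (lemma [saddle_close]), and the backward orbit of [y],
    which lies in [Omega], follows it back.  As [S] depends only on how close
    one wants to be to the origin, the closeness to [Omega] can be chosen after
    it.  Thus a point of [Omega] near the origin moves to [y], which is far
    from [A]. *)
Lemma origin_not_attracting (Omega A : set 'rV[R]_3) :
  attractor F setT Omega -> attractor F Omega A ->
  (forall p, A p -> p = 0 \/ 1 < p 0 2) -> ~ A 0.
Proof.
move=> [_ _ Oinv Ostable _] [_ AO _ Astable _] A0z A0.
(* a neighborhood of [A] with two components; the first is well inside the
   sphere [sqnorm3 = 1 / 4], which the second does not meet *)
pose U := [set p : 'rV[R]_3 | sqnorm3 p < 1 / 16] `|` [set p : 'rV[R]_3 | 1 < p 0 2].
have oU : open U.
  rewrite openE => p [pU|pU].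
    have : \forall q \near p, sqnorm3 q < 1 / 16.
      exact: cvgr_lt (sqnorm3_continuous p) _ pU.
    by apply: filterS => q; left.
  have : \forall q \near p, 1 < (q : 'rV[R]_3) 0 2.
    have c2 : q 0 2 @[q --> p] --> (p 0 2 : R) by exact: coord_continuous.
    exact: cvgr_gt c2 _ pU.
  by apply: filterS => q; right.
have AU : A `<=` U.
  move=> p /A0z[->|]; last by right.
  by left => /=; rewrite /sqnorm3 !mxE; lra.
have [W [oW AW Worb]] := Astable U oU AU.
have [e e0 eW] : exists2 e : R, 0 < e & forall p, sqnorm3 p < e -> W p.
  by apply: nbhs0_sqnorm3; apply: open_nbhs_nbhs; split => //; exact: AW.
have [K K0 sep] := lorenz_separation 10 r (8 / 3 : R) (1 / 4).
(* the delay needed by [saddle_close] to come within [e / 4] *)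
pose S := 4 / e.
have S0 : 0 < S by rewrite divr_gt0.
have Se : S * (e / 4) = 1 by rewrite /S; field; lra.
(* the factor undoes the divergence of solutions during the time [S]; 1 / 64
   keeps [y] outside [U] *)
pose d := Num.min (e / 8 * expR (- (K * S))) (1 / 64).
have d0 : 0 < d by rewrite lt_min !mulr_gt0 ?expR_gt0//=; lra.
pose V := [set p : 'rV[R]_3 | exists2 w, Omega w & sqnorm3 (p - w) < d].
have oV : open V.
  rewrite openE => p [w Ow pw].
  have cB : sqnorm3 (q - w) @[q --> p] --> sqnorm3 (p - w).
    have cw : q - w @[q --> p] --> p - w by exact: cvgB cvg_id (cvg_cst _).
    exact: cvg_comp cw (sqnorm3_continuous (p - w)).
  have : \forall q \near p, sqnorm3 (q - w) < d by exact: cvgr_lt cB _ pw.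
  by apply: filterS => q qw; exists w.
have OV : Omega `<=` V.
  by move=> p Op; exists p => //; rewrite subrr /sqnorm3 !mxE expr0n !addr0.
have [WO [oWO OWO WOorb]] := Ostable V oV OV.
have [e1 e10 e1W] : exists2 e1 : R, 0 < e1 & forall p, sqnorm3 p < e1 -> WO p.
  by apply: nbhs0_sqnorm3; apply: open_nbhs_nbhs; split => //; apply/OWO/AO.
pose m := Num.min e1 (Num.min (e / 4) (1 / 4)).
have m0 : 0 < m by rewrite !lt_min e10/=; lra.
have [me1 me m4] : [/\ m <= e1, m <= e / 4 & m <= 1 / 4].
  by rewrite /m; split; rewrite !ge_min lexx ?orbT.
(* a point of the cone, of squared norm [m ^+ 2 / 2 < m] since [m <= 1] *)
pose x : 'rV[R]_3 := \row_(i < 3) [:: m / 2; m / 2; 0]`_i.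
have sx : saddle x = m ^+ 2 / 4 by rewrite /saddle !mxE/=; field.
have nx : sqnorm3 x < m by rewrite /sqnorm3 !mxE/=; nra.
have sx0 : 0 < saddle x by rewrite sx divr_gt0 ?exprn_gt0.
have xorb : orbit_in F x `[0, +oo[ V by apply: WOorb => //; apply: e1W; lra.
have T1 : 0 <= (saddle x)^-1 by rewrite invr_ge0 ltW.
have [y1 xy1 _] : exists2 y, flow F x (saddle x)^-1 y & V y.
  by apply: xorb; rewrite /= in_itv/= T1.
have [u [us ux _]] := flow_solution _ _ _ _ _ T1 xy1.
have [s1 /andP[s10 s1T] us1] :
    exists2 s, 0 <= s <= (saddle x)^-1 & 1 / 4 <= sqnorm3 (u s).
  by apply: saddle_escape; rewrite ?ux.
have sol T : 0 <= T <= s1 -> solution_on F `[0, T] u.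
  move=> /andP[_ Ts]; apply: solution_sub us => z; rewrite /= !in_itv/= => /andP[-> zT].
  by rewrite (le_trans zT)// (le_trans Ts).
have [T [/andP[T0 Ts1] uT uTle]] :
    exists T, [/\ 0 <= T <= s1, sqnorm3 (u T) = 1 / 4 &
    forall s, 0 <= s <= T -> sqnorm3 (u s) <= 1 / 4].
  apply: first_exit => //; last by rewrite ux; lra.
  move=> s st; apply: (@continuous_comp _ _ _ u sqnorm3); last exact: sqnorm3_continuous.
  by apply: (solution_continuous _ _ _ _ _ _ st); apply: sol; rewrite s10 lexx.
have usT : solution_on F `[0, T] u by apply: sol; rewrite T0.
have [c [/andP[c0 cT] cS uc]] :
    exists c, [/\ 0 <= c <= T, T - c <= S & sqnorm3 (u c) <= e / 4].
  apply: saddle_close => //; [lra|by rewrite Se|].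
  by rewrite ux; lra.
have [y Oy yd] : V (u T).
  apply: (lorenz_orbit_in _ _ _ _ _ _ _ T0 _ usT); last by rewrite ux; exact: xorb.
  by rewrite /= in_itv/= T0.
have Tc0 : 0 <= T - c by lra.
have [p0 yp0 Op0] := Oinv y Oy (- (T - c)) I.
have [w [ws wy wp0]] := flow_solution_backward _ _ _ _ _ Tc0 yp0.
have wsh : solution_on F `[c, T] (fun s => w (s - T)).
  have := solution_shift _ _ _ _ _ (- T) ws.
  by rewrite opprK (_ : - (T - c) + T = c) ?add0r//; ring.
have wsh0 : solution_on F `[0, T - c] (fun s => w (s + (c - T))).
  have := solution_shift _ _ _ _ _ (c - T) ws.
  have -> : - (T - c) - (c - T) = 0 by ring.
  by have -> : 0 - (c - T) = T - c by ring.
(* only the bound on [u] enters, as the orbit of [y] could be large *)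
have close : sqnorm3 (p0 - u c) <= e / 8.
  have usc : solution_on F `[c, T] u.
    apply: solution_sub usT => z; rewrite /= !in_itv/= => /andP[cz ->].
    by rewrite (le_trans c0).
  have uM t : `[c, T]%classic t -> u t 0 1 ^+ 2 + u t 0 2 ^+ 2 <= 1 / 4.
    rewrite /= in_itv/= => /andP[ct tT].
    apply: le_trans (uTle t _); last by rewrite tT (le_trans c0).
    by rewrite /sqnorm3 -addrA lerDr sqr_ge0.
  have [_] := sep _ _ _ _ cT wsh usc uM.
  rewrite subrr wy (_ : c - T = - (T - c)) ?wp0; last by ring.
  move=> /le_trans; apply.
  have yd' : sqnorm3 (y - u T) <= d.
    by rewrite /sqnorm3 !mxE; move: yd; rewrite /sqnorm3 !mxE; lra.
  apply: le_trans (_ : d * expR (K * S) <= _).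
    by apply: ler_pM; rewrite ?sqnorm3_ge0 ?expR_ge0// ler_expR ler_wpM2l.
  apply: le_trans (_ : e / 8 * expR (- (K * S)) * expR (K * S) <= _).
    by rewrite ler_pM2r ?expR_gt0// ge_min lexx.
  by rewrite -mulrA -expRD addNr expR0 mulr1.
have Wp0 : W p0 by apply: eW; have := sqnorm3B p0 (u c); lra.
have Jc : `[0, +oo[%classic (T - c) by rewrite /= in_itv/= Tc0.
have : U y.
  have := lorenz_orbit_in _ _ _ _ _ U _ Tc0 Jc wsh0.
  rewrite /= add0r (_ : T - c + (c - T) = 0); last by ring.
  by rewrite (_ : c - T = - (T - c)) ?wp0 ?wy; [apply; exact: Worb|ring].
have {}yd : sqnorm3 (u T - y) < 1 / 64.
  by apply: lt_le_trans yd _; rewrite ge_min lexx orbT.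
move=> [/= yU|/= yU]; first by have := sqnorm3B (u T) y; lra.
move: uT yd; rewrite /sqnorm3 !mxE => uT yd.
have h0 := sqr_ge0 (u T 0 0); have h1 := sqr_ge0 (u T 0 1).
have h3 := sqr_ge0 (u T 0 0 - y 0 0); have h4 := sqr_ge0 (u T 0 1 - y 0 1).
have u2 : u T 0 2 <= 1 / 2 by nra.
by nra.
Qed.

End instability.

(** * The degree as a signed count of equilibria *)

Lemma brouwer_degree_regular {R : realType} n (U : set 'rV[R]_n.+1) f :
  regular_at_zero U f -> brouwer_degree U f = signed_zero_count U f.
Proof. by move=> fU; rewrite /brouwer_degree asboolT. Qed.

(** Zeros in the neighborhood are equilibria, hence belong to the isolated set,
    which lies in the interior. *)
Lemma isolating_zeros {R : realType} n (F : 'rV[R]_n.+1 -> 'rV[R]_n.+1) K N :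
  isolating_neighborhood F K N ->
  N° `&` F @^-1` [set 0] = K `&` F @^-1` [set 0].
Proof.
move=> iN; have [_ _ KN _] := iN; apply/seteqP; split=> x [Nx Fx].
  by split=> //; apply: (equilibrium_isolating _ _ _ _ _ iN) => //; exact: interior_subset.
by split=> //; exact: KN.
Qed.

(** For the same reason there are no zeros on the frontier. *)
Lemma isolating_regular {R : realType} n (F : 'rV[R]_n.+1 -> 'rV[R]_n.+1) K N :
  compact N -> isolating_neighborhood F K N -> C1_on setT F ->
  (forall x, F x = 0 -> \det (jacobian F x) != 0) ->
  regular_at_zero N° F.
Proof.
move=> cN iN F1 Fdet; have [_ _ KN _] := iN; split=> [|x _||x _]; last 1 first.
- exact: Fdet.
- by apply: continuous_subspaceT => x; apply: differentiable_continuous; have [] := F1 x I.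
- exact: F1.
- move=> x [xN nx] Fx; apply: nx.
  rewrite (_ : N°° = N°); last by apply/interior_id/open_interior.
  apply/KN/(equilibrium_isolating _ _ _ _ _ iN) => //.
  have clN : closed N by apply: compact_closed => //; exact: norm_hausdorff.
  by rewrite (closure_id N).1//; apply: closure_subset xN; exact: interior_subset.
Qed.

Section degree.
Context {R : realType}.
Variable r : R.
Hypothesis r_large : 27 / 2 <= r.
Local Notation F := (lorenz 10 r (8 / 3)).
Local Notation c := (Num.sqrt (8 / 3 * (r - 1))).

Let c_gt0 : 0 < c.
Proof. by rewrite sqrtr_gt0; move: r_large; lra. Qed.

Lemma equilibriumP p : F p = 0 <-> [\/ p = 0, p = wing r c | p = wing r (- c)].
Proof. by apply: lorenz_equilibria; move: r_large; lra. Qed.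

Lemma wing_neq0 x : wing r x <> 0.
Proof. by move=> /rowP/(_ 2); rewrite !mxE/=; move: r_large; lra. Qed.

Lemma wing_inj (x y : R) : wing r x = wing r y -> x = y.
Proof. by move=> /rowP/(_ 0); rewrite !mxE. Qed.

Lemma sgz_det0 : sgz (\det (jacobian F 0)) = 1.
Proof. by apply: gtr0_sgz; rewrite det_jacobian_lorenz !mxE; move: r_large; lra. Qed.

(** At height [r - 1] the linear term of the determinant cancels and
    [- 20 * x ^+ 2] is left. *)
Lemma sgz_det_wing x : x ^+ 2 = c ^+ 2 -> sgz (\det (jacobian F (wing r x))) = -1.
Proof.
move=> xc; apply: ltr0_sgz; rewrite det_jacobian_lorenz !mxE/=.
have : 0 < x ^+ 2 by rewrite xc exprn_gt0.
lra.
Qed.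

Lemma lorenz_regular K N : isolating_block F K N -> regular_at_zero N° F.
Proof.
move=> [cN iN _]; apply: (isolating_regular _ _ _ _ cN iN); first exact: lorenz_C1.
move=> p /equilibriumP[->|->|->]; rewrite -sgz_eq0.
- by rewrite sgz_det0.
- by rewrite sgz_det_wing.
- by rewrite sgz_det_wing ?sqrrN.
Qed.

Lemma degree_zeros K N : isolating_block F K N ->
  brouwer_degree N° F =
  \sum_(p \in K `&` F @^-1` [set 0]) sgz (\det (jacobian F p)).
Proof.
move=> bN; have [_ iN _] := bN.
rewrite brouwer_degree_regular; last exact: lorenz_regular bN.
by rewrite /signed_zero_count (isolating_zeros _ _ _ _ iN).
Qed.

Lemma degree_origin K N : isolating_block F K N -> K 0 ->
  ~ K (wing r c) -> ~ K (wing r (- c)) -> brouwer_degree N° F = 1.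
Proof.
move=> bN K0 Kp Kn; rewrite (degree_zeros _ _ bN).
rewrite (_ : _ `&` _ = [set 0]) ?fsbig_set1 ?sgz_det0//.
apply/seteqP; split=> [p [Kp0 Fp0]|_ ->]; last first.
  by split; [exact: K0|exact: (equilibriumP 0).2 (Or31 _ _ erefl)].
have [->//|pE|pE] := (equilibriumP p).1 Fp0; rewrite pE in Kp0.
  by case: (Kp Kp0).
by case: (Kn Kp0).
Qed.

Lemma degree_all K N : isolating_block F K N -> K 0 ->
  K (wing r c) -> K (wing r (- c)) -> brouwer_degree N° F = -1.
Proof.
move=> bN K0 Kp Kn; rewrite (degree_zeros _ _ bN).
rewrite (_ : _ `&` _ = [set 0] `|` ([set wing r c] `|` [set wing r (- c)])).
  (* the sum is computed for abstract signs, to keep the Jacobians folded *)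
  have sum3 (D : 'rV[R]_3 -> int) : D 0 = 1 -> D (wing r c) = -1 ->
      D (wing r (- c)) = -1 ->
      \sum_(p \in [set 0] `|` ([set wing r c] `|` [set wing r (- c)])) D p = -1.
    move=> D0 Dp Dn; rewrite !fsbigU0/= ?fsbig_set1 ?D0 ?Dp ?Dn//.
    - by move=> _ [-> /wing_inj]; have := c_gt0; lra.
    - by move=> _ [-> [/esym/wing_neq0|/esym/wing_neq0]].
  apply: sum3; first exact: sgz_det0.
    exact: sgz_det_wing.
  by apply: sgz_det_wing; rewrite sqrrN.
apply/seteqP; split=> [p [_ Fp0]|p [->|[->|->]]].
- have [->|->|->] := (equilibriumP p).1 Fp0; [by left|by right; left|].
  by right; right.
- by split; [exact: K0|exact: (equilibriumP _).2 (Or31 _ _ erefl)].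
- by split; [exact: Kp|exact: (equilibriumP _).2 (Or32 _ _ erefl)].
- by split; [exact: Kn|exact: (equilibriumP _).2 (Or33 _ _ erefl)].
Qed.

End degree.

(** * Degrees of the blocks *)

Theorem proposition3p2 (R : realType) (rH r : R)
    (HrH : homoclinic_value rH) (Hr : rH < r < 24 + 6 / 100)
    (Omega A L : set 'rV[R]_3)
    (HOmega : global_attractor (lorenz 10 r (8 / 3)) Omega)
    (HAL : attractor_repeller_decomposition (lorenz 10 r (8 / 3)) Omega A L)
    (HA : exists p q : 'rV[R]_3, p <> q /\ A = [set p; q]) :
  (forall N : set 'rV[R]_3,
     isolating_block (lorenz 10 r (8 / 3)) L N ->
     brouwer_degree N° (lorenz 10 r (8 / 3)) = 1) /\
  (forall Nhat : set 'rV[R]_3,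
     isolating_block (lorenz 10 r (8 / 3)) Omega Nhat ->
     brouwer_degree Nhat° (lorenz 10 r (8 / 3)) = -1).
Proof.
have r13 : 27 / 2 <= r.
  by case: HrH => /andP[rH1 _] _; case/andP: Hr => r1 _; lra.
set F := lorenz 10 r (8 / 3) in HOmega HAL *.
pose c := Num.sqrt (8 / 3 * (r - 1)).
have F0 : F 0 = 0 by apply/(equilibriumP _ r13)/Or31.
have Fp : F (wing r c) = 0 by apply/(equilibriumP _ r13)/Or32.
have Fn : F (wing r (- c)) = 0 by apply/(equilibriumP _ r13)/Or33.
have [OmegaA Omega_omega] := HOmega.
(* an equilibrium is its own omega-limit point, and [Omega] contains them all *)
have Omega_eq x : F x = 0 -> Omega x.
  by move=> Fx; apply: (Omega_omega x).2; exact: equilibrium_omega_limit.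
have [_ attrA _ LE] := HAL.
have [_ _ invA _ _] := attrA.
have [p [q [pq AE]]] := HA.
have Feq x : A x -> F x = 0.
  rewrite AE => -[->|->].
    by apply: (lorenz_invariant_pair _ _ _ _ _ pq); rewrite -AE.
  apply: (lorenz_invariant_pair _ _ _ _ p) => [/esym//|].
  by rewrite setUC -AE.
have A0 : ~ A 0.
  apply: (origin_not_attracting _ r13 _ _ OmegaA attrA) => x.
  by move=> /Feq/(equilibriumP _ r13)[->|->|->]; [left|right|right]; rewrite ?mxE//=; lra.
(* two of the three equilibria, not the origin *)
have Awing : A (wing r c) /\ A (wing r (- c)).
  have Aw x : A x -> x = wing r c \/ x = wing r (- c).
    move=> Ax; case/(equilibriumP _ r13): (Feq x Ax) => [x0|->|->]; [|by left|by right].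
    by rewrite x0 in Ax.
  have Ap : A p by rewrite AE; left.
  have Aq : A q by rewrite AE; right.
  case: (Aw p Ap) (Aw q Aq) => pE [] qE; rewrite pE qE// in pq Ap Aq *.
have Lwing x : A x -> F x = 0 -> ~ L x.
  move=> Ax Fx; rewrite LE => -[_ /seteqP[+ _]] => /(_ x).
  by apply; split => //; exact: equilibrium_omega_limit.
have L0 : L 0.
  rewrite LE; split; first exact: Omega_eq.
  by apply/seteqP; split=> // x [/(lorenz_equilibrium_omega _ _ _ _ F0) -> /A0].
split=> [N bN|N bN].
- by apply: (degree_origin _ r13 _ _ bN) => //; apply: Lwing => //; case: Awing.
- by apply: (degree_all _ r13 _ _ bN); exact: Omega_eq.
Qed.
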